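(* Let $F$ be an algebraically closed field of characteristic $0$, let $n\ge2$, $\Omega=\{1,\dots,n\}$, and let $\mathfrak{A}$ be the universal associative envelope of the anti-Jordan triple system of all $n\times n$ matrices over $F$, with generators $e_{i,j}$. For all $i,j,k,\ell\in\Omega$ with $(i,j)\ne(1,1)$ the following identities hold in $\mathfrak{A}$. (1) If $(k,\ell)\ne(1,1)$: $$\begin{aligned}e_{1,i}e_{j,1}\cdot e_{1,k}e_{\ell,1}=\;&\tfrac12\Big[\delta_{i,1}\delta_{j,k}\delta_{\ell,1}\widehat\delta_{j,1}(e_{1,1}^4-e_{1,1}^2)+\Big\{\delta_{j,k}\widehat\delta_{i,1}\delta_{i,\ell}\Big(\delta_{j,1}+\widehat\delta_{j,1}\widehat\delta_{\ell,1}\big(2\delta_{j,\ell}+\widehat\delta_{j,\ell}\big)\Big)\\&+\widehat\delta_{j,k}\widehat\delta_{\ell,1}\delta_{k,\ell}\big(\widehat\delta_{j,1}\widehat\delta_{j,\ell}\delta_{i,j}+\delta_{i,1}\delta_{j,1}\big)\Big\}(e_{1,1}^4+e_{1,1}^2)\Big]\\&-\delta_{j,k}\Big(\delta_{j,1}+\widehat\delta_{j,1}\big(\delta_{\ell,1}\widehat\delta_{i,1}+\widehat\delta_{\ell,1}\big)\Big)e_{1,i}e_{\ell,1}.\end{aligned}$$ (2) $$\begin{aligned}e_{1,i}e_{j,1}\cdot e_{1,1}^2e_{1,k}=\;&\big(-\delta_{j,1}\widehat\delta_{i,1}\delta_{k,1}+\widehat\delta_{j,1}\delta_{i,j}\delta_{k,i}\big)e_{1,1}^2e_{1,i}+\delta_{j,1}\delta_{k,1}\widehat\delta_{i,1}e_{1,i}\\&+\delta_{i,j}\widehat\delta_{j,1}\Big(\tfrac12\delta_{k,1}(e_{1,1}^3+e_{1,1})+\widehat\delta_{k,i}\widehat\delta_{k,1}e_{1,1}^2e_{1,k}\Big).\end{aligned}$$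 (3) $$e_{1,i}e_{j,1}\cdot e_{1,1}^4=\delta_{j,1}e_{1,i}e_{1,1}+\widehat\delta_{j,1}\widehat\delta_{i,1}\delta_{i,j}\tfrac12(e_{1,1}^4+e_{1,1}^2).$$ (4) If $\ell\ne1$: $\;e_{1,i}e_{j,1}\cdot e_{1,k}e_{1,1}e_{\ell,1}=-\delta_{j,k}e_{1,i}e_{1,1}e_{\ell,1}.$
   Context: $\delta_{i,j}$ is the Kronecker delta and $\widehat\delta_{i,j}=1-\delta_{i,j}$. The anti-Jordan triple system of all $n\times n$ matrices over $F$ has trilinear product $\langle a,b,c\rangle=abc-cba$. Its universal associative envelope is $\mathfrak{A}=F\langle X\rangle/I$, where $F\langle X\rangle$ is the free unital associative algebra on symbols $X=\{e_{i,j}\}_{i,j\in\Omega}$ (with $e_{i,j}$ corresponding to the matrix unit $E_{i,j}$), and $I$ is the two-sided ideal generated by all elements $e_{i,j}e_{k,\ell}e_{m,t}-e_{m,t}e_{k,\ell}e_{i,j}-\delta_{j,k}\delta_{\ell,m}e_{i,t}+\delta_{t,k}\delta_{\ell,i}e_{m,j}$ for $i,j,k,\ell,m,t\in\Omega$. The image of $e_{i,j}$ in $\mathfrak{A}$ is again denoted $e_{i,j}$. *)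

(* Defs.v *)
From HB Require Import structures.
From mathcomp Require Import all_boot all_order all_algebra.
From mathcomp Require Import ring_quotient boolp finmap monalg.

Set Implicit Arguments.
Unset Strict Implicit.
Unset Printing Implicit Defensive.

Import GRing.Theory.
Local Open Scope ring_scope.
Local Open Scope quotient_scope.

Definition kdelta (F : nzRingType) (I : eqType) (i j : I) : F := (i == j)%:R.

Definition kdeltaC (F : nzRingType) (I : eqType) (i j : I) : F :=
  1 - kdelta F i j.

Definition ajt_prod (F : nzRingType) (n : nat) (a b c : 'M[F]_n) : 'M[F]_n :=
  a *m b *m c - c *m b *m a.

Lemma ajt_prod_delta_mx (F : nzRingType) (n : nat) (i j k l m t : 'I_n) :
  ajt_prod (delta_mx i j) (delta_mx k l) (delta_mx m t) =
  (kdelta F j k * kdelta F l m) *: delta_mx i t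
  - (kdelta F t k * kdelta F l i) *: delta_mx m j.
Proof.
rewrite /ajt_prod /kdelta !mul_delta_mx_cond -!scaler_nat -!scalemxAl.
by rewrite !mul_delta_mx_cond -!scaler_nat !scalerA.
Qed.

Inductive two_sided_ideal (R : nzRingType) (S : R -> Prop) : R -> Prop :=
| Ideal_gen x : S x -> two_sided_ideal S x
| Ideal_0 : two_sided_ideal S 0
| Ideal_add x y :
    two_sided_ideal S x -> two_sided_ideal S y -> two_sided_ideal S (x + y)
| Ideal_mull a x : two_sided_ideal S x -> two_sided_ideal S (a * x)
| Ideal_mulr a x : two_sided_ideal S x -> two_sided_ideal S (x * a).

Section Envelope.
Variables (F : fieldType) (n : nat).

(* Noncommutative polynomials: the monoid algebra of the free monoid of words. *)
Local Notation word := {fmonom ('I_n * 'I_n)%type}.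
Local Notation free_alg := {malg F[word]}.

Definition free_gen (i j : 'I_n) : free_alg := << fmu (i, j) >>.

(* The correction terms are the image of the triple product of matrix units,
   as computed in ajt_prod_delta_mx. *)
Definition ajt_rel (i j k l m t : 'I_n) : free_alg :=
  let x := free_gen in
  x i j * x k l * x m t - x m t * x k l * x i j
  - (kdelta F j k * kdelta F l m) *: x i t
  + (kdelta F t k * kdelta F l i) *: x m j.

Definition env_ideal (x : free_alg) : bool :=
  `[< two_sided_ideal
        (fun r => exists i j k l m t : 'I_n, r = ajt_rel i j k l m t) x >].

Lemma env_ideal_zmod_closed : zmod_closed env_ideal.
Proof.
split=> [|x y]; first by apply/asboolP; apply: Ideal_0.
move=> /asboolP Ix /asboolP Iy; apply/asboolP; apply: Ideal_add => //.
by rewrite -mulN1r; apply: Ideal_mull.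
Qed.

HB.instance Definition _ :=
  GRing.isZmodClosed.Build free_alg env_ideal env_ideal_zmod_closed.

Lemma env_idealMl a x : x \in env_ideal -> a * x \in env_ideal.
Proof. by move=> /asboolP Ix; apply/asboolP; apply: Ideal_mull. Qed.

Lemma env_idealMr a x : x \in env_ideal -> x * a \in env_ideal.
Proof. by move=> /asboolP Ix; apply/asboolP; apply: Ideal_mulr. Qed.

(* The relations have no constant term, so 1 is not in the ideal and the
   quotient is a nontrivial ring. *)
Lemma free_gen_coef1 (i j : 'I_n) : mcoeff (mone : word) (free_gen i j) = 0.
Proof. by rewrite mcoeffU1 -fdeg_eq0 fdegU. Qed.

Lemma env_ideal_coef1 (x : free_alg) : x \in env_ideal -> mcoeff (mone : word) x = 0.
Proof.
move=> /asboolP; elim=> [_ [i [j [k [l [m [t ->]]]]]]| |y z _ y0 _ z0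
                        |a y _ y0|a y _ y0].
- rewrite /ajt_rel mcoeffD !mcoeffB !mcoeffZ !rmorphM /= !free_gen_coef1.
  by rewrite !(mulr0, mul0r) !subr0 addr0.
- exact: mcoeff0.
- by rewrite mcoeffD y0 z0 addr0.
- by rewrite rmorphM /= y0 mulr0.
- by rewrite rmorphM /= y0 mul0r.
Qed.

Lemma env_ideal1 : 1 \notin env_ideal.
Proof.
by apply/negP=> /env_ideal_coef1 /eqP; rewrite mcoeff1 eqxx oner_eq0.
Qed.

Definition env_ideal_pred : zmodClosed free_alg :=
  GRing.ZmodClosed.clone free_alg env_ideal _.

Definition envelope := Quotient.quot env_ideal_pred.

HB.instance Definition _ := GRing.Zmodule.on envelope.
HB.instance Definition _ :
  EqQuotient free_alg (Quotient.equiv env_ideal_pred) envelope :=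
  EqQuotient.on envelope.
HB.instance Definition _ := ZmodQuotient.on envelope.

Lemma envelope_eqP (x y : free_alg) :
  reflect (\pi_envelope x = \pi_envelope y) (x - y \in env_ideal).
Proof. by rewrite Quotient.idealrBE; apply: eqP. Qed.

Definition env_one : envelope := lift_cst envelope 1.
Definition env_mul := lift_op2 envelope *%R.
Definition env_scale (a : F) := lift_op1 envelope ( *:%R a).

Canonical pi_env_one_morph := PiConst env_one.

Lemma pi_env_mul : {morph \pi_envelope : x y / x * y >-> env_mul x y}.
Proof.
move=> x y; unlock env_mul; apply/envelope_eqP.
rewrite -[x * y](subrK (x * repr (\pi_envelope y))) -mulrBr -addrA -mulrBl.
apply: rpredD; [apply: env_idealMl|apply: env_idealMr];
  by apply/envelope_eqP; rewrite reprK.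
Qed.
Canonical pi_env_mul_morph := PiMorph2 pi_env_mul.

Lemma pi_env_scale a : {morph \pi_envelope : x / a *: x >-> env_scale a x}.
Proof.
move=> x; unlock env_scale; apply/envelope_eqP.
rewrite -scalerBr -mul_malgC; apply: env_idealMl.
by apply/envelope_eqP; rewrite reprK.
Qed.
Canonical pi_env_scale_morph a := PiMorph1 (pi_env_scale a).

Lemma env_mulA : associative env_mul.
Proof. by move=> x y z; rewrite -[x]reprK -[y]reprK -[z]reprK !piE mulrA. Qed.

Lemma env_mul1 : left_id env_one env_mul.
Proof. by move=> x; rewrite -[x]reprK !piE mul1r. Qed.

Lemma env_mulr1 : right_id env_one env_mul.
Proof. by move=> x; rewrite -[x]reprK !piE mulr1. Qed.

Lemma env_mulDl : left_distributive env_mul +%R.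
Proof. by move=> x y z; rewrite -[x]reprK -[y]reprK -[z]reprK !piE mulrDl. Qed.

Lemma env_mulDr : right_distributive env_mul +%R.
Proof. by move=> x y z; rewrite -[x]reprK -[y]reprK -[z]reprK !piE mulrDr. Qed.

Lemma env_one_neq0 : env_one != 0.
Proof. by rewrite piE Quotient.equivE subr0 env_ideal1. Qed.

HB.instance Definition _ := GRing.Zmodule_isNzRing.Build envelope
  env_mulA env_mul1 env_mulr1 env_mulDl env_mulDr env_one_neq0.

HB.instance Definition _ := @isNzRingQuotient.Build free_alg
  (Quotient.equiv env_ideal_pred) 0 -%R +%R 1 *%R envelope (lock _) pi_env_mul.

Lemma env_scaleA a b x : env_scale a (env_scale b x) = env_scale (a * b) x.
Proof. by rewrite -[x]reprK !piE scalerA. Qed.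

Lemma env_scale1 : left_id 1 env_scale.
Proof. by move=> x; rewrite -[x]reprK !piE scale1r. Qed.

Lemma env_scaleDr : right_distributive env_scale +%R.
Proof. by move=> a x y; rewrite -[x]reprK -[y]reprK !piE scalerDr. Qed.

Lemma env_scaleDl x : {morph env_scale^~ x : a b / a + b}.
Proof. by move=> a b; rewrite -[x]reprK !piE scalerDl. Qed.

HB.instance Definition _ := GRing.Zmodule_isLmodule.Build F envelope
  env_scaleA env_scale1 env_scaleDr env_scaleDl.

Lemma env_scaleAl (a : F) (x y : envelope) : a *: (x * y) = a *: x * y.
Proof.
by rewrite /GRing.scale /GRing.mul /= -[x]reprK -[y]reprK !piE scalerAl.
Qed.

HB.instance Definition _ :=
  GRing.Lmodule_isLalgebra.Build F envelope env_scaleAl.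

Lemma free_scaleAr (a : F) (x y : free_alg) : a *: (x * y) = x * (a *: y).
Proof.
rewrite [x * y]malgME (malgMEw (fsubset_refl _) (msuppZ_le a y)).
rewrite scaler_sumr; apply: eq_bigr => u _.
rewrite scaler_sumr; apply: eq_bigr => v _.
apply/malgP=> w; rewrite mcoeffZ !mcoeffU mcoeffZ mulrnAr.
by rewrite mulrCA.
Qed.

Lemma env_scaleAr (a : F) (x y : envelope) : a *: (x * y) = x * (a *: y).
Proof.
by rewrite /GRing.scale /GRing.mul /= -[x]reprK -[y]reprK !piE free_scaleAr.
Qed.

HB.instance Definition _ :=
  GRing.Lalgebra_isAlgebra.Build F envelope env_scaleAr.

Definition env_gen (i j : 'I_n) : envelope := \pi_envelope (free_gen i j).

Lemma env_gen_rel (i j k l m t : 'I_n) :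
  env_gen i j * env_gen k l * env_gen m t
  - env_gen m t * env_gen k l * env_gen i j
  - (kdelta F j k * kdelta F l m) *: env_gen i t
  + (kdelta F t k * kdelta F l i) *: env_gen m j = 0.
Proof.
have piZ a x : a *: \pi_envelope x = \pi_envelope (a *: x).
  by rewrite pi_env_scale.
rewrite /env_gen !piZ -!(rmorphM \pi_envelope) -!rmorphB -rmorphD.
rewrite -(rmorph0 \pi_envelope).
apply/envelope_eqP; rewrite subr0; apply/asboolP; apply: Ideal_gen.
by exists i, j, k, l, m, t.
Qed.

End Envelope.

(* Main.v *)
Require Import Defs.
From mathcomp Require Import all_boot all_order all_algebra.
From mathcomp Require Import ring.

(** The relations say that the generators [e_ij] satisfy
    [abc - cba = <a, b, c>], where the triple product on the right is that of
    matrix units.  Two families of representations of these relations are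
    visible: [e_ij -> s E_ij] with [s^2 = 1], and [e_ij -> s E_ji] with
    [s^2 = -1].  The proof shows that every [e_ij] is a sum [y_ij + z_ij], where
    [y] multiplies as in the first family, [z] as in the second, and
    [y z = z y = 0] ([ajt_system_split]).

    The splitting comes from the even products.  In a word of four letters, the
    exchange of letters 1 and 3 and that of letters 2 and 4 commute; performing
    them in the two orders and comparing the corrections gives a relation
    between words of length two ([bracket_quadratic]).  Evaluated on matrix
    units it says that [e_ij e_kl = 0] if [j <> k] and [l <> i], and that
    [e_ij e_jl] is independent of [j] if [i <> l].  The part [y_il] is then the
    word [e_ij e_jm e_ml], for any [j], [m] with [m <> i] or [j <> l], and
    [z_il] is minus its reversal: for [m <> i] and [j <> l] the defining
    relation says that the difference of the two words is [e_il].  All vanishing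
    products between the parts follow by choosing the free indices so that the
    two adjacent letters in the middle multiply to zero.

    Transposition [e_ij -> e_ji] preserves the relations up to the sign of the
    triple product.  Everything is therefore proved for relations with a sign
    [s] such that [s^2 = 1], so that each fact about [y] also gives one about
    [z].

    Put [P_oo = y_oo^2] and [Q_ij = - z_oi z_jo].  Then
    [e_oi e_jo = d_ij P_oo - Q_ij], [e_oo^2 = P_oo - Q_oo],
    [e_oo^4 = P_oo + Q_oo], the [Q_ij] multiply as matrix units and are
    annihilated by [P_oo] on both sides; the four identities become comparisons
    of coefficients. *)

Set Implicit Arguments.
Unset Strict Implicit.
Unset Printing Implicit Defensive.

Import GRing.Theory.
Local Open Scope ring_scope.

(** * Signed systems and the quadratic relations *)

Definition unit_bracket (A : nzRingType) (I : eqType) (x : I -> I -> A)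
    (i j k l m t : I) : A :=
  x i t *+ ((j == k) && (l == m)) - x m j *+ ((t == k) && (l == i)).

(** The sign [s] makes the notion stable under transposition; [s = 1] is the
    anti-Jordan triple system of matrices. *)
Definition ajt_system (F : fieldType) (A : algType F) (I : eqType) (s : F)
    (x : I -> I -> A) : Prop :=
  forall i j k l m t,
    x i j * x k l * x m t - x m t * x k l * x i j
    = s *: unit_bracket x i j k l m t.

Definition transpose (I A : Type) (x : I -> I -> A) : I -> I -> A :=
  fun i j => x j i.

Lemma transpose_system (F : fieldType) (A : algType F) (I : eqType) (s : F)
    (x : I -> I -> A) :
  ajt_system s x -> ajt_system (- s) (transpose x).
Proof.
move=> relx i j k l m t; rewrite /transpose relx /unit_bracket scaleNr -scalerN.
rewrite opprB ![k == _]eq_sym ![m == _]eq_sym ![i == _]eq_sym.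
by rewrite [(l == i) && _]andbC [(l == m) && _]andbC.
Qed.

Section Quadratic.
Variables (F : fieldType) (A : algType F) (I : eqType).
Variables (s : F) (x : I -> I -> A).
Hypotheses (ss1 : s * s = 1) (two_neq0 : 2 != 0 :> F) (relx : ajt_system s x).

Lemma sign_scalerK (a : A) : s *: (s *: a) = a.
Proof. by rewrite scalerA ss1 scale1r. Qed.

(** With [[a,b,c]] for [abc - cba], this is the identity
    [c [b,a,d] + [a,b,c] d = [a,d,c] b + a [b,c,d]] of associative algebras,
    which records the two ways of passing from [abcd] to [cdab]. *)
Lemma bracket_quadratic (a1 a2 b1 b2 c1 c2 d1 d2 : I) :
  x c1 c2 * unit_bracket x b1 b2 a1 a2 d1 d2
    + unit_bracket x a1 a2 b1 b2 c1 c2 * x d1 d2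
  = unit_bracket x a1 a2 d1 d2 c1 c2 * x b1 b2
    + x a1 a2 * unit_bracket x b1 b2 c1 c2 d1 d2.
Proof.
have E i j k l m t : unit_bracket x i j k l m t
    = s *: (x i j * x k l * x m t - x m t * x k l * x i j).
  by rewrite relx sign_scalerK.
rewrite !E -!scalerAl -!scalerAr -!scalerDr; congr (_ *: _).
rewrite !mulrBr !mulrBl !mulrA.
by rewrite addrC subrKA [RHS]addrC addrA subrK.
Qed.

(** The quadratic relation for [a, b, c, d = e_ik, e_ki, e_ij, e_kl] gives twice
    the product. *)
Lemma mul_unit_eq0 (i j k l : I) : j != k -> l != i -> x i j * x k l = 0.
Proof.
move=> njk nli.
have := bracket_quadratic i k k i i j k l.
rewrite /unit_bracket !eqxx (negbTE njk) (negbTE nli) /= ?andbF.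
rewrite !(mulr0n, mulr1n, subr0, sub0r, mulr0, mul0r, addr0, add0r, oppr0).
move/eqP; rewrite -mulr2n -scaler_nat scaler_eq0 (negbTE two_neq0).
by move/eqP.
Qed.

(** The quadratic relation for [a, b, c, d = e_im, e_mi, e_ij, e_jl]. *)
Lemma mul_unit_mid (i l j m : I) : i != l -> x i j * x j l = x i m * x m l.
Proof.
move=> nil; have [->//|njm] := eqVneq j m.
have := bracket_quadratic i m m i i j j l.
rewrite /unit_bracket !eqxx [m == j]eq_sym (negbTE njm).
rewrite [l == i]eq_sym (negbTE nil) /= ?andbF.
by rewrite !(mulr0n, mulr1n, subr0, sub0r, mulr0, mul0r, addr0, add0r, oppr0).
Qed.
End Quadratic.

(** * The splitting of a system into two parts *)

Section Splitting.
Variables (F : fieldType) (A : algType F) (I : eqType).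
(* A map without fixed points is how at least two indices are given. *)
Variables (other : I -> I).
Hypotheses (otherP : forall i, other i != i) (two_neq0 : 2 != 0 :> F).

(** The word [x_ij x_jm x_ml] in a representation [x_ij = r E_ij] with
    [r^2 = s] is [s x_il].  Here [j = other l], so that [x_jm x_ml = 0] if
    instead [x_ij = r E_ji]. *)
Definition hompart (s : F) (x : I -> I -> A) (i l : I) : A :=
  s *: (x i (other l) * x (other l) (other i) * x (other i) l).

Definition antipart (s : F) (x : I -> I -> A) : I -> I -> A :=
  transpose (hompart (- s) (transpose x)).

Lemma hompartE (s : F) (x : I -> I -> A) (ss1 : s * s = 1)
    (relx : ajt_system s x) (i j l m : I) :
  (m != i) || (j != l) -> hompart s x i l = s *: (x i j * x j m * x m l).
Proof.
have mid := mul_unit_mid ss1 relx; rewrite /hompart => /orP[nmi|njl].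
  rewrite -mulrA (mid (other l) l _ m) ?otherP // mulrA.
  by rewrite (mid i m _ j) // eq_sym.
rewrite (mid i _ _ j) 1?eq_sym ?otherP //.
by rewrite -mulrA (mid j l _ m) // mulrA.
Qed.

Section Products.
Variables (s : F) (x : I -> I -> A).
Hypotheses (ss1 : s * s = 1) (relx : ajt_system s x).
Let y := hompart s x.
Let z := antipart s x.
Let relxT : ajt_system (- s) (transpose x) := transpose_system relx.
Let ssN1 : - s * - s = 1. Proof. by rewrite mulrNN. Qed.

(** The two parts are the two words in the defining relation for
    [e_ia e_ab e_bj], with [a <> j] and [b <> i]. *)
Lemma hompart_sum (i j : I) : x i j = y i j + z i j.
Proof.
rewrite /y /z /antipart /transpose /hompart scaleNr -scalerBr.
have /(congr1 ( *:%R s)) := relx i (other j) (other j) (other i) (other i) j.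
rewrite sign_scalerK // /unit_bracket !eqxx [j == _]eq_sym.
by rewrite (negbTE (otherP j)) subr0 => ->.
Qed.

Let mul_mid_eq0 (a b c d a' b' : A) :
  c * d = 0 -> (a * b * c) * (d * a' * b') = 0.
Proof. by move=> cd0; rewrite !mulrA -(mulrA _ c) cd0 mulr0 !mul0r. Qed.

Let unit0 := mul_unit_eq0 ss1 two_neq0 relx.

Lemma hompart_mul_antipart (i j k l : I) : y i j * z k l = 0.
Proof.
(* The middle letters become x_aj x_bl with a = other l and b = other j. *)
rewrite /y (hompartE ss1 relx (m := other l) (j := other j)) ?otherP ?orbT //.
rewrite /z /antipart /transpose.
rewrite (hompartE ssN1 relxT (m := other l) (j := other j)) ?otherP //.
rewrite /transpose -scalerAl -scalerAr.
by rewrite mul_mid_eq0 ?scaler0 // unit0 // eq_sym.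
Qed.

Lemma antipart_mul_hompart (i j k l : I) : z k l * y i j = 0.
Proof.
rewrite /y (hompartE ss1 relx (m := other i) (j := other k)) ?otherP //.
rewrite /z /antipart /transpose.
rewrite (hompartE ssN1 relxT (m := other i) (j := other k)) ?otherP ?orbT //.
rewrite /transpose -scalerAl -scalerAr.
by rewrite mul_mid_eq0 ?scaler0 // unit0 // eq_sym.
Qed.

Lemma hompart_mul_eq0 (i j k l : I) : j != k -> y i j * y k l = 0.
Proof.
move=> njk.
(* The middle letters become x_aj x_kk with a = other k. *)
rewrite /y (hompartE ss1 relx (m := other k) (j := other j)) ?otherP ?orbT //.
rewrite (hompartE ss1 relx (m := other k) (j := k)) ?otherP //.
by rewrite -scalerAl -scalerAr mul_mid_eq0 ?scaler0 // unit0 // eq_sym.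
Qed.
End Products.

Section MatrixUnits.
Variables (s : F) (x : I -> I -> A).
Hypotheses (ss1 : s * s = 1) (relx : ajt_system s x).
Let y := hompart s x.
Let relxT : ajt_system (- s) (transpose x) := transpose_system relx.
Let ssN1 : - s * - s = 1. Proof. by rewrite mulrNN. Qed.

(** The product of the antiparts vanishes here: transposed, it is
    [y_ji y_lj] with [i <> l]. *)
Lemma hompart_mul_offdiag (i j l : I) : i != l -> y i j * y j l = x i j * x j l.
Proof.
move=> nil; rewrite !(hompart_sum ss1 relx) mulrDl !mulrDr.
rewrite (hompart_mul_antipart ss1 relx) (antipart_mul_hompart ss1 relx).
by rewrite addr0 add0r (hompart_mul_eq0 ssN1 relxT) // addr0.
Qed.

Let triple_offdiag (i j k l : I) : (i != k) || (j != l) ->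
  y i j * y j k * y k l = s *: y i l.
Proof.
case/orP => [nik|njl].
  rewrite [in RHS]/y (hompartE ss1 relx (m := k) (j := j)) 1?eq_sym ?nik //.
  rewrite sign_scalerK // -hompart_mul_offdiag // [x k l](hompart_sum ss1 relx).
  rewrite mulrDr -(mulrA _ _ (antipart _ _ _ _)).
  by rewrite (hompart_mul_antipart ss1 relx) mulr0 addr0.
rewrite [in RHS]/y (hompartE ss1 relx (m := k) (j := j)) ?njl ?orbT //.
rewrite sign_scalerK // -!mulrA -hompart_mul_offdiag //.
rewrite [x i j](hompart_sum ss1 relx) mulrDl [antipart _ _ _ _ * _]mulrA.
by rewrite (antipart_mul_hompart ss1 relx) mul0r addr0.
Qed.

(** For [i = l] the middle index cannot be changed in the word [x_ij x_ji]
    itself.  Writing [y_ij] as a triple product through [m] and [p <> i] changes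
    it, since for [j <> m] both triple products that occur are already known. *)
Lemma hompart_mul_mid (i l j m : I) : y i j * y j l = y i m * y m l.
Proof.
have [->//|njm] := eqVneq j m; pose p := other i.
rewrite -[y i j](sign_scalerK ss1).
rewrite -(@triple_offdiag i m p j) 1?eq_sym ?otherP //.
rewrite -scalerAl -!mulrA (mulrA (y m p)) triple_offdiag 1?eq_sym ?njm //.
by rewrite -scalerAr sign_scalerK.
Qed.

Lemma hompart_mul3 (i j k l : I) : y i j * y j k * y k l = s *: y i l.
Proof.
by rewrite (hompart_mul_mid _ _ _ (other l)) triple_offdiag ?otherP ?orbT.
Qed.
End MatrixUnits.
End Splitting.

(** In matrix terms, [y_ij] behaves as [r E_ij] with [r^2 = 1] and [z_ij] as
    [r E_ji] with [r^2 = -1]. *)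
Record split_system (A : nzRingType) (I : eqType) (x y z : I -> I -> A) :
  Prop := SplitSystem {
    split_sum i j : x i j = y i j + z i j;
    split_yz i j k l : y i j * z k l = 0;
    split_zy i j k l : z i j * y k l = 0;
    split_yy0 i j k l : j != k -> y i j * y k l = 0;
    split_yy i l j m : y i j * y j l = y i m * y m l;
    split_yyy i j k l : y i j * y j k * y k l = y i l;
    split_zz0 i j k l : i != l -> z i j * z k l = 0;
    split_zzz i j k l : z i j * z k i * z l k = - z l j
  }.

Lemma ajt_system_split (F : fieldType) (A : algType F) (I : eqType)
    (x : I -> I -> A) (o o1 : I) :
  2 != 0 :> F -> o1 != o -> ajt_system 1 x -> exists y z, split_system x y z.
Proof.
move=> two_neq0 no1 relx; pose other i := if i == o then o1 else o.
have otherP i : other i != i.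
  by rewrite /other; case: ifP => [/eqP->//|/negbT]; rewrite eq_sym.
have ss1 : 1 * 1 = 1 :> F by exact: mulr1.
have ssN1 : - 1 * - 1 = 1 :> F by rewrite mulrNN mulr1.
have relxT := transpose_system relx.
exists (hompart other 1 x), (antipart other 1 x).
split=> *.
- exact: hompart_sum.
- exact: (hompart_mul_antipart otherP).
- exact: (antipart_mul_hompart otherP).
- exact: (hompart_mul_eq0 otherP).
- exact: (hompart_mul_mid otherP).
- by rewrite (hompart_mul3 otherP) // scale1r.
- exact: (hompart_mul_eq0 otherP two_neq0 ssN1 relxT).
- by rewrite [LHS](hompart_mul3 otherP two_neq0 ssN1 relxT) scaleN1r.
Qed.

(** * Products of elements of one row and one column *)

Section CornerProducts.
Variables (F : fieldType) (A : algType F) (I : eqType).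
Variables (x y z : I -> I -> A) (o : I).
Hypotheses (two_neq0 : 2 != 0 :> F) (split_x : split_system x y z).

Local Notation d := (kdelta F).
Local Notation d' := (kdeltaC F).

(* The products x_oi x_jo of a row by a column element are combinations of the
   idempotent p and of the q i j, which multiply as negated matrix units. *)
Let p := y o o * y o o.
Let q (i j : I) := z o i * z j o.

Let kdelta_refl (i : I) : d i i = 1. Proof. by rewrite /kdelta eqxx. Qed.

Let kdeltaP (i j : I) (a b : A) :
  (i = j -> a = b) -> (i != j -> a = 0) -> a = d i j *: b.
Proof.
rewrite /kdelta => eq_ab a0; have [ij|nij] := eqVneq i j.
  by rewrite scale1r eq_ab.
by rewrite scale0r a0.
Qed.

Let sum := split_sum split_x.
Let yz := split_yz split_x.
Let zy := split_zy split_x.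

Let y_row_col (i j : I) : y o i * y j o = d i j *: p.
Proof.
apply: kdeltaP => [<-|]; [exact: (split_yy split_x)|exact: (split_yy0 split_x)].
Qed.

Let p_y (k : I) : p * y o k = y o k.
Proof. exact: (split_yyy split_x). Qed.

Let q_z (i j k l : I) : q i j * z k l = - d j l *: z k i.
Proof.
rewrite /q -mulrA scaleNr -scalerN; apply: kdeltaP => [->|njl].
  by rewrite mulrA (split_zzz split_x).
by rewrite (split_zz0 split_x) ?mulr0.
Qed.

Let xx (i j : I) : x o i * x j o = d i j *: p + q i j.
Proof. by rewrite !sum mulrDl !mulrDr yz zy y_row_col addr0 add0r. Qed.

Let pq (i j : I) : p * q i j = 0.
Proof. by rewrite /p /q -mulrA [X in _ * X]mulrA yz mul0r mulr0. Qed.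

Let qp (i j : I) : q i j * p = 0.
Proof. by rewrite /p /q -mulrA [X in _ * X]mulrA zy mul0r mulr0. Qed.

Let pp : p * p = p.
Proof. by rewrite {2}/p mulrA p_y. Qed.

Let pz (k l : I) : p * z k l = 0.
Proof. by rewrite /p -mulrA yz mulr0. Qed.

Let qy (i j k l : I) : q i j * y k l = 0.
Proof. by rewrite /q -mulrA zy mulr0. Qed.

Let qq (i j k l : I) : q i j * q k l = - d j k *: q i l.
Proof. by rewrite {2}/q mulrA q_z -scalerAl. Qed.

Let sqr_oo : x o o ^+ 2 = p + q o o.
Proof. by rewrite expr2 xx kdelta_refl scale1r. Qed.

Let cube_oo : x o o ^+ 3 = y o o - z o o.
Proof.
rewrite exprSr sqr_oo sum mulrDl !mulrDr p_y pz qy q_z kdelta_refl.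
by rewrite scaleN1r addr0 add0r.
Qed.

Let cubeD : x o o ^+ 3 + x o o = 2 *: y o o.
Proof. by rewrite cube_oo sum addrACA addNr addr0 scaler_nat. Qed.

Let exp4_oo : x o o ^+ 4 = p - q o o.
Proof.
rewrite (exprM _ 2 2) sqr_oo expr2 mulrDl !mulrDr pp pq qp qq kdelta_refl.
by rewrite scaleN1r addr0 add0r.
Qed.

Let exp4_sqrD : x o o ^+ 4 + x o o ^+ 2 = 2 *: p.
Proof. by rewrite exp4_oo sqr_oo addrACA addNr addr0 scaler_nat. Qed.

Let exp4_sqrB : x o o ^+ 4 - x o o ^+ 2 = - 2 *: q o o.
Proof.
by rewrite exp4_oo sqr_oo opprD addrACA subrr add0r scaleNr scaler_nat -opprD.
Qed.

Let sqr_row (k : I) : x o o ^+ 2 * x o k = y o k - d o k *: z o o.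
Proof.
by rewrite sqr_oo sum mulrDl !mulrDr p_y pz qy q_z addr0 add0r scaleNr.
Qed.

Variables (i j k l : I).
Hypothesis nij : (i, j) != (o, o).

Lemma row_col_mul_exp4 : (x o i * x j o) * x o o ^+ 4 =
      d j o *: (x o i * x o o)
      + (d' j o * d' i o * d i j * 2^-1) *: (x o o ^+ 4 + x o o ^+ 2).
Proof.
rewrite !xx exp4_sqrD exp4_oo scalerA mulfVK // mulrDl !mulrBr -!scalerAl.
rewrite pp pq qp qq scaler0 subr0 sub0r.
rewrite scaleNr opprK scalerDr scalerA addrAC -scalerDl.
congr (_ *: _ + _).
move: nij; rewrite /kdeltaC /kdelta xpair_eqE.
have [->|nio] := eqVneq i o; first rewrite [o == j]eq_sym.
  by move/negbTE=> /= ->; ring.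
by have [->|njo] := eqVneq j o; rewrite ?(negbTE nio) => _ /=; ring.
Qed.

Lemma row_col_mul_row_corner_col : l != o ->
      (x o i * x j o) * (x o k * x o o * x l o) =
      - (d j k *: (x o i * x o o * x l o)).
Proof.
move=> nlo.
have row_col a : x o a * x o o * x l o = - z l a.
  rewrite xx sum mulrDl !mulrDr -!scalerAl pz qy q_z kdelta_refl scaleN1r.
  rewrite /p -(mulrA (y o o)) y_row_col.
  by rewrite /kdelta [_ == l]eq_sym (negbTE nlo) scale0r mulr0 !scaler0 !add0r.
rewrite !row_col scalerN opprK.
by rewrite xx mulrN mulrDl -scalerAl pz q_z scaler0 add0r scaleNr opprK.
Qed.

Lemma row_col_mul_sqr_row : (x o i * x j o) * (x o o ^+ 2 * x o k) =
      (- (d j o * d' i o * d k o) + d' j o * d i j * d k i)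
        *: (x o o ^+ 2 * x o i)
      + (d j o * d k o * d' i o) *: x o i
      + (d i j * d' j o)
        *: ((2^-1 * d k o) *: (x o o ^+ 3 + x o o)
            + (d' k i * d' k o) *: (x o o ^+ 2 * x o k)).
Proof.
rewrite xx !sqr_row cubeD sum [LHS]mulrDl ![in LHS]mulrBr.
rewrite -!scalerAl -!scalerAr p_y pz qy q_z.
rewrite !scaler0 subr0 sub0r scaleNr scalerN opprK !scalerA.
rewrite [2^-1 * _]mulrC -[_ * 2^-1 * 2]mulrA mulVf // mulr1.
move: nij; rewrite xpair_eqE /kdeltaC /kdelta [o == i]eq_sym [o == k]eq_sym.
have simp := (scale0r, scale1r, scaleN1r, scaler0, mulr0, mul0r, mulr1, mul1r,
              subrr, subr0, oppr0, addr0, add0r).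
have [->|njo] := eqVneq j o.
  rewrite andbT => /negbTE ->; have [->|nko] := eqVneq k o; rewrite !simp //.
  by rewrite addrA addNr add0r.
have [->|nij'] := eqVneq i j => _; last by rewrite !simp.
rewrite (negbTE njo); have [->|nko] := eqVneq k o.
  by rewrite eq_sym (negbTE njo) !simp.
by have [->|nkj] := eqVneq k j; rewrite !simp.
Qed.

Lemma row_col_mul_row_col : (k, l) != (o, o) ->
      (x o i * x j o) * (x o k * x l o) =
      2^-1 *: ((d i o * d j k * d l o * d' j o) *: (x o o ^+ 4 - x o o ^+ 2)
               + (d j k * d' i o * d i l
                    * (d j o + d' j o * d' l o * (2 * d j l + d' j l))
                  + d' j k * d' l o * d k l
                    * (d' j o * d' j l * d i j + d i o * d j o))
                 *: (x o o ^+ 4 + x o o ^+ 2))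
      - (d j k * (d j o + d' j o * (d l o * d' i o + d' l o)))
        *: (x o i * x l o).
Proof.
move=> nkl.
rewrite !xx exp4_sqrD exp4_sqrB.
rewrite [LHS]mulrDl ![in LHS]mulrDr -!scalerAl -!scalerAr pp pq qp qq.
rewrite !scaler0 addr0 add0r.
set a := _ * d' j o; set b := (_ + _ : F); set c := d j k * _.
(* The coefficient a carries d i o * d l o, so q o o may be read as q i l. *)
have -> : a *: (- 2 *: q o o) = a *: (- 2 *: q i l).
  rewrite /a /kdelta; have [->|_] := eqVneq i o.
    by have [->|_] := eqVneq l o; rewrite ?mulr0 ?mul0r ?scale0r.
  by rewrite !mul0r !scale0r.
have -> : 2^-1 *: (a *: (- 2 *: q i l) + b *: (2 *: p))
      - c *: (d i l *: p + q i l)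
    = (b - c * d i l) *: p - (a + c) *: q i l.
  have -> : a *: (- 2 *: q i l) = 2 *: - (a *: q i l).
    by rewrite scaleNr !scalerN !scalerA mulrC.
  have -> : b *: (2 *: p) = 2 *: (b *: p) by rewrite !scalerA mulrC.
  rewrite -scalerDr scalerA mulVf // scale1r scalerDr scalerA scalerBl scalerDl.
  by rewrite [- _ + _]addrC !opprD addrACA.
rewrite scaleNr scalerA; congr (_ *: _ - _ *: _); last first.
  by rewrite /a /c /kdeltaC; ring.
move: nij nkl; rewrite !xpair_eqE /b /c /kdeltaC /kdelta.
have [->|njk] := eqVneq j k.
  have [<-|nil] := eqVneq i l; last first.
    have [eik|nik] := eqVneq i k; last by move=> _ _ /=; ring.
    by rewrite -eik (negbTE nil) => _ _ /=; ring.
  rewrite [k == i]eq_sym; have [->|nio] := eqVneq i o.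
    by rewrite [o == k]eq_sym => /negbTE /= -> _ /=; ring.
  have [->|nko] := eqVneq k o => _ _; last by case: (i == k) => /=; ring.
  by rewrite (negbTE nio) /=; ring.
have [<-|nkl'] := eqVneq k l; last by move=> _ _ /=; ring.
rewrite (negbTE njk) andbb => + /negbTE -> /=.
have [->|nio] := eqVneq i o.
  by rewrite [o == j]eq_sym => /negbTE /= -> /=; ring.
have [->|njo] := eqVneq j o => _ /=; last by ring.
by rewrite (negbTE nio) /=; ring.
Qed.

End CornerProducts.

(** * The universal envelope *)

Lemma env_gen_system (F : fieldType) (n : nat) :
  ajt_system 1 (@env_gen F n).
Proof.
move=> i j k l m t; rewrite scale1r /unit_bracket.
have /eqP := env_gen_rel F i j k l m t.
rewrite /kdelta -!natrM !mulnb !scaler_nat -addrA addr_eq0 => /eqP ->.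
by rewrite opprD opprK.
Qed.

Theorem proposition4p5 (F : closedFieldType) (charF0 : [pchar F] =i pred0)
    (n : nat) (n_ge2 : (2 <= n)%N) (i j k l : 'I_n) :
  let o : 'I_n := Ordinal (ltnW n_ge2) in
  let e : 'I_n -> 'I_n -> envelope F n := @env_gen F n in
  let d : 'I_n -> 'I_n -> F := @kdelta F 'I_n in
  let d' : 'I_n -> 'I_n -> F := @kdeltaC F 'I_n in
  (i, j) <> (o, o) ->
  [/\ (k, l) <> (o, o) ->
      (e o i * e j o) * (e o k * e l o) =
      2^-1 *: ((d i o * d j k * d l o * d' j o) *: (e o o ^+ 4 - e o o ^+ 2)
               + (d j k * d' i o * d i l
                    * (d j o + d' j o * d' l o * (2 * d j l + d' j l))
                  + d' j k * d' l o * d k l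
                    * (d' j o * d' j l * d i j + d i o * d j o))
                 *: (e o o ^+ 4 + e o o ^+ 2))
      - (d j k * (d j o + d' j o * (d l o * d' i o + d' l o)))
        *: (e o i * e l o),

      (e o i * e j o) * (e o o ^+ 2 * e o k) =
      (- (d j o * d' i o * d k o) + d' j o * d i j * d k i)
        *: (e o o ^+ 2 * e o i)
      + (d j o * d k o * d' i o) *: e o i
      + (d i j * d' j o)
        *: ((2^-1 * d k o) *: (e o o ^+ 3 + e o o)
            + (d' k i * d' k o) *: (e o o ^+ 2 * e o k)),

      (e o i * e j o) * e o o ^+ 4 =
      d j o *: (e o i * e o o)
      + (d' j o * d' i o * d i j * 2^-1) *: (e o o ^+ 4 + e o o ^+ 2)
    & l <> o ->
      (e o i * e j o) * (e o k * e o o * e l o) =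
      - (d j k *: (e o i * e o o * e l o))].
Proof.
move=> o e d d' /eqP nij.
have two_neq0 : 2 != 0 :> F by move/pcharf0P: charF0 => ->.
have no1 : Ordinal n_ge2 != o by [].
have [y [z split_e]] := ajt_system_split two_neq0 no1 (@env_gen_system F n).
split.
- by move/eqP; apply: (row_col_mul_row_col two_neq0 split_e).
- exact: (row_col_mul_sqr_row two_neq0 split_e).
- exact: (row_col_mul_exp4 two_neq0 split_e).
- by move/eqP; apply: (row_col_mul_row_corner_col split_e).
Qed.
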